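(* Let $\Delta=\bigsqcup_{i\in\mathbb Z}\Delta(i)$ be a $\mathbb Z$-grading of an irreducible reduced crystallographic root system with compatible positive system $\Delta^+=\Delta(0)^+\sqcup\Delta(1)\sqcup\Delta(2)\sqcup\cdots$. If $I$ is a lower ideal of $(\Delta(1),\preccurlyeq)$ and $I^{c}=\Delta(1)\setminus I$, then $\Delta(\ge1)\setminus\langle I^{c}\rangle$ is a bi-convex subset of $\Delta^+$, where $\Delta(\ge1)=\bigsqcup_{j\ge1}\Delta(j)$.
   Context: A $\mathbb Z$-grading of $\Delta$ is a disjoint decomposition $\Delta=\bigsqcup_{i\in\mathbb Z}\Delta(i)$ such that whenever $\gamma_1\in\Delta(i_1)$, $\gamma_2\in\Delta(i_2)$ and $\gamma_1+\gamma_2\in\Delta$, then $\gamma_1+\gamma_2\in\Delta(i_1+i_2)$; compatibility means $\Delta^+=\Delta(0)^+\sqcup\bigsqcup_{i\ge1}\Delta(i)$ with $\Delta(0)^+$ a positive system of the root system $\Delta(0)$. The order: $\mu\preccurlyeq\gamma$ iff $\gamma-\mu$ is a nonnegative integer combination of simple roots; lower ideal = downward closed subset. For $J\subset\Delta^+$: $J^1=J$, $J^k=(J+J^{k-1})\cap\Delta$ for $k\ge2$, $\langle J\rangle=\bigcup_{k\ge1}J^k$. A subset $M\subset\Delta^+$ is bi-convex if both $M$ and $\Delta^+\setminus M$ are closed (if $\gamma_1,\gamma_2$ lie in the set and $\gamma_1+\gamma_2\in\Delta$, then $\gamma_1+\gamma_2$ lies in the set). *)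

(* Defs.v *)
From HB Require Import structures.
From mathcomp Require Import all_boot all_order all_algebra.
From mathcomp Require Import boolp classical_sets cardinality reals.

Set Implicit Arguments.
Unset Strict Implicit.
Unset Printing Implicit Defensive.

Import Order.TTheory GRing.Theory Num.Theory.

Local Open Scope classical_set_scope.
Local Open Scope ring_scope.

(** A Euclidean space is a finite-dimensional real vector space [V] with an
    inner product [dot : {dot V for idfun}] (a positive definite symmetric
    bilinear form). *)

Section RootSystems.
Variables (R : realType) (V : vectType R) (dot : {dot V for idfun}).

Implicit Types (a b g m : V) (Phi P A B : set V) (Pi : seq V).

Definition cartan_num b a : R := 2 * dot b a / dot a a.

Definition root_reflection a b : V := b - cartan_num b a *: a.

(** Spanning [V] is not required: [Phi] is a root system in its linear span.
    So the notion applies to [Delta] and to the subsystem [Delta(0)] alike, and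
    the empty set is a root system, as it has to be when [Delta(0)] is empty. *)
Definition root_system Phi : Prop :=
  [/\ finite_set Phi, ~ Phi 0 &
      forall a b, Phi a -> Phi b -> Phi (root_reflection a b)].

Definition crystallographic Phi : Prop :=
  forall a b, Phi a -> Phi b -> cartan_num b a \is a Num.int.

Definition reduced Phi : Prop :=
  forall a (c : R), Phi a -> Phi (c *: a) -> c = 1 \/ c = -1.

Definition irreducible Phi : Prop :=
  Phi !=set0 /\
  forall A B, A `|` B = Phi -> A `&` B = set0 ->
    (forall a b, A a -> B b -> dot a b = 0) -> A = set0 \/ B = set0.

Definition nncomb Pi : set V :=
  [set g | exists c : V -> nat, g = \sum_(a <- Pi) a *+ c a].

(** [positive_roots] below is the positive system whose set of simple roots
    is [Pi]. *)
Definition simple_system Phi Pi : Prop :=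
  [/\ [set` Pi] `<=` Phi, free Pi &
      forall g, Phi g -> nncomb Pi g \/ nncomb Pi (- g)].

Definition positive_roots Phi Pi : set V := Phi `&` nncomb Pi.

Definition positive_system Phi P : Prop :=
  exists2 Pi, simple_system Phi Pi & P = positive_roots Phi Pi.

Definition root_le Pi m g : Prop := nncomb Pi (g - m).

Definition lower_ideal Pi (X I : set V) : Prop :=
  I `<=` X /\ forall m g, I g -> X m -> root_le Pi m g -> I m.

(** [D i] stands for [Delta(i)]; it may be empty. *)
Definition Zgrading Phi (D : int -> set V) : Prop :=
  [/\ \bigcup_i D i = Phi, trivIset setT D &
      forall i j a b, D i a -> D j b -> Phi (a + b) -> D (i + j) (a + b)].

Definition compatible (D : int -> set V) P : Prop :=
  exists D0p : set V,
    [/\ root_system (D 0), positive_system (D 0) D0p &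
        P = D0p `|` \bigcup_(i in [set i : int | 1 <= i]) D i].

(** [J^k]; the value at [k = 0], which the mathematical definition leaves out,
    is [J] and is never used. *)
Definition rpow Phi (J : set V) (k : nat) : set V :=
  iter k.-1 (fun K => [set a + b | a in J & b in K] `&` Phi) J.

Definition rgen Phi (J : set V) : set V :=
  \bigcup_(k in [set k : nat | (1 <= k)%N]) rpow Phi J k.

Definition root_closed Phi (M : set V) : Prop :=
  forall a b, M a -> M b -> Phi (a + b) -> M (a + b).

Definition biconvex Phi P (M : set V) : Prop :=
  [/\ M `<=` P, root_closed Phi M & root_closed Phi (P `\` M)].

End RootSystems.

(* Main.v *)
(** Two roots with negative inner product sum to a root or to [0]; this gives
    a Jacobi-type exchange property for sums of three roots. With it, sums
    [x = a + x'] with [a] in [J = D 1 `\` I] can be reassociated, and every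
    statement about [rgen Delta J] follows by induction on the degree from the
    fact that adding a positive root of degree [0] keeps [J] stable, which is
    what it means for [I] to be a lower ideal.  For the closedness of the
    complement of [rgen Delta J], write [a + b = x + y] with [a] in [J]; the
    exchange property makes [x - a] or [y - a] a root or [0], and this root is
    split off. *)

Require Import Defs.
From HB Require Import structures.
From mathcomp Require Import all_boot all_order all_algebra.
From mathcomp Require Import boolp classical_sets cardinality reals.
From mathcomp Require Import zify lra.

Set Implicit Arguments.
Unset Strict Implicit.
Unset Printing Implicit Defensive.

Import Order.TTheory GRing.Theory Num.Theory.

Local Open Scope classical_set_scope.
Local Open Scope ring_scope.

(** * Sums of roots controlled by signs of inner products *)

Section RootAddition.
Variables (R : realType) (V : vectType R) (dot : {dot V for idfun}).

Lemma dot_sym u v : dot u v = dot v u.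
Proof. by rewrite hermC /= expr0 mul1r. Qed.

Lemma dot_addl u v w : dot (u + v) w = dot u w + dot v w.
Proof. exact: linearDl. Qed.

Lemma dot_oppl u v : dot (- u) v = - dot u v.
Proof. exact: linearNl. Qed.

Lemma dot_sqr_gt0 u : u != 0 -> 0 < dot u u.
Proof. exact: neq0_dnorm_gt0. Qed.

Variable Phi : set V.
Hypothesis Phi_root : root_system dot Phi.

Let Phi_neq0 a : Phi a -> a != 0.
Proof. by case: Phi_root => _ nz _ Pa; apply/eqP => a0; rewrite a0 in Pa. Qed.

Lemma cartan_num_dot a b : Phi a -> cartan_num dot b a * dot a a = 2 * dot b a.
Proof.
by move=> /Phi_neq0/dot_sqr_gt0/lt0r_neq0 aa0; rewrite /cartan_num divfK.
Qed.

Lemma rootN a : Phi a -> Phi (- a).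
Proof.
move=> Pa; case: (Phi_root) => _ _ /(_ a a Pa Pa).
rewrite /root_reflection /cartan_num mulfK ?lt0r_neq0 ?dot_sqr_gt0 ?Phi_neq0 //.
by rewrite scaler_nat mulr2n opprD addNKr.
Qed.

Hypothesis Phi_crys : crystallographic dot Phi.

(** The Cartan number is a negative integer, and the value -1 would make the reflection of [b] equal
    to [b + a]; so it is at most -2. *)
Lemma cartan_num_le_neg2 a b : Phi a -> Phi b -> dot b a < 0 ->
  ~ Phi (b + a) -> dot b a <= - dot a a.
Proof.
move=> Pa Pb ba_lt0 nPba; have aa_gt0 := dot_sqr_gt0 (Phi_neq0 Pa).
have := Phi_crys Pa Pb; have := cartan_num_dot b Pa.
case: (Phi_root) => _ _ /(_ a b Pa Pb); rewrite /root_reflection.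
set p := cartan_num dot b a => refl pE /intrP [n pn].
have p_lt0 : p < 0 by rewrite -(pmulr_llt0 _ aa_gt0) pE pmulr_rlt0.
have nN1 : n != -1.
  by apply/eqP => nE; apply: nPba; move: refl; rewrite pn nE scaleN1r opprK.
have n_le : n <= -2 by move: p_lt0; rewrite pn ltrz0; lia.
have p_le : p <= -2 by rewrite pn (_ : -2 = (-2)%:~R) ?ler_int.
nra.
Qed.

(** If [a + b] is not a root, the previous bound holds with both roles of [a] and [b]; adding the
    two gives [a + b] a squared norm at most 0. *)
Lemma root_add_neg a b : Phi a -> Phi b -> dot a b < 0 ->
  a + b = 0 \/ Phi (a + b).
Proof.
move=> Pa Pb ab_lt0; have [|nP] := pselect (Phi (a + b)); first by right.
left; apply/eqP; apply: contraT => /dot_sqr_gt0.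
rewrite dot_addl !(dot_sym _ (a + b)) !dot_addl (dot_sym b a).
have := cartan_num_le_neg2 Pb Pa ab_lt0 nP.
rewrite addrC in nP; have := cartan_num_le_neg2 Pa Pb _ nP.
rewrite (dot_sym b a) => /(_ ab_lt0); lra.
Qed.

(** Put [s = a + b + c]. If both alternatives fail, [c] has nonnegative product with [a] and [b],
    while [s] has nonpositive product with both, because [s - a = b + c] and [s - b = a + c]. Then
    [a + b] has squared norm at most 0. *)
Lemma root_exchange a b c : Phi a -> Phi b -> Phi c -> Phi (a + b) ->
  Phi (a + b + c) ->
  (a + c = 0 \/ Phi (a + c)) \/ (b + c = 0 \/ Phi (b + c)).
Proof.
move=> Pa Pb Pc Pab Ps; apply: contrapT => /not_orP[nac nbc].
have ge0 u v : Phi u -> Phi v -> ~ (u + v = 0 \/ Phi (u + v)) -> 0 <= dot u v.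
  by move=> Pu Pv nuv; rewrite leNgt; apply/negP => /(root_add_neg Pu Pv).
have ac := ge0 _ _ Pa Pc nac; have bc := ge0 _ _ Pb Pc nbc.
have := ge0 _ _ (rootN Pa) Ps; rewrite (addrA _ (a + b)) addKr => /(_ nbc).
have := ge0 _ _ (rootN Pb) Ps.
rewrite (addrC a b) (addrA _ (b + a)) addKr => /(_ nac).
have := dot_sqr_gt0 (Phi_neq0 Pab).
rewrite !dot_oppl !(dot_addl, dot_sym _ (_ + _)).
rewrite (dot_sym b a) (dot_sym c a) (dot_sym c b); lra.
Qed.

End RootAddition.

Lemma nncombD (R : realType) (V : vectType R) (Pi : seq V) (a b : V) :
  nncomb Pi a -> nncomb Pi b -> nncomb Pi (a + b).
Proof.
move=> [c ->] [d ->]; exists (fun v => (c v + d v)%N).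
by rewrite -big_split; apply: eq_bigr => v _; rewrite mulrnDr.
Qed.

(** * Powers of a set of degree-one roots in a graded root system *)

Section GradedPowers.
Variables (R : realType) (V : vectType R) (dot : {dot V for idfun}).
Variables (Phi P : set V) (D : int -> set V) (J : set V).
Hypotheses (Phi_root : root_system dot Phi) (Phi_crys : crystallographic dot Phi).
Hypotheses (D_grading : Zgrading Phi D) (J_sub : J `<=` D 1).

Lemma grade_root i a : D i a -> Phi a.
Proof. by case: D_grading => <- _ _ Da; exists i. Qed.

Lemma grade_exists a : Phi a -> exists i, D i a.
Proof. by case: D_grading => <- _ _ [i _ Da]; exists i. Qed.

Lemma grade_inj i j a : D i a -> D j a -> i = j.
Proof. by case: D_grading => _ tD _ Di Dj; apply: tD => //; exists a. Qed.

Lemma gradeD i j a b : D i a -> D j b -> Phi (a + b) -> D (i + j) (a + b).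
Proof. by case: D_grading => _ _; apply. Qed.

Lemma gradeB i j a b : D i a -> D j b -> Phi (b - a) -> D (j - i) (b - a).
Proof.
move=> Da Db Pba; have [k Dk] := grade_exists Pba.
suff -> : j - i = k by [].
have Dki : D (k + i) b.
  by rewrite -[b](subrK a); apply: gradeD; rewrite // subrK; apply: grade_root Db.
by rewrite (grade_inj Db Dki) addrK.
Qed.

Lemma rpow_grade k x : rpow Phi J k.+1 x -> D k.+1 x.
Proof.
elim: k x => [x /J_sub //|k IH x [[a Ja [b /IH Db <-]] Px]].
by rewrite intS; apply: gradeD => //; apply: J_sub.
Qed.

Lemma rpowS k a b : J a -> rpow Phi J k.+1 b -> Phi (a + b) ->
  rpow Phi J k.+2 (a + b).
Proof. by move=> Ja Jb Pab; split=> //; exists a => //; exists b. Qed.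

(** Powers grow by one element of [J] on the left. For [x = a + x'] the exchange property regroups
    the sum as [x' + (a + y)] or [a + (x' + y)] with the bracket a root, and induction on [i]
    applies. *)
Lemma rpowD i j x y : rpow Phi J i.+1 x -> rpow Phi J j.+1 y -> Phi (x + y) ->
  rpow Phi J (i + j).+2 (x + y).
Proof.
elim: i j x y => [|i IH] j x y; first exact: rpowS.
move=> [[a Ja [x' Jx' <-]] Px] Jy Ps.
have Da := J_sub Ja; have Dx' := rpow_grade Jx'; have Dy := rpow_grade Jy.
have Ds := gradeD (gradeD Da Dx' Px) Dy Ps.
have [[ay0|Pay]|[xy0|Pxy]] := root_exchange Phi_root Phi_crys (grade_root Da)
  (grade_root Dx') (grade_root Dy) Px Ps.
(* If [a + y = 0], the whole sum is [x'], whose degree is too small. *)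
- move: Ds; rewrite (addrAC a) ay0 (add0r x') => /(grade_inj Dx'); lia.
- have E : a + x' + y = x' + (a + y) by rewrite addrAC addrC.
  rewrite E in Ps *; rewrite addSnnS; apply: IH => //; exact: rpowS.
- move: Ds; rewrite -(addrA a) xy0 addr0 => /(grade_inj Da); lia.
- rewrite -addrA in Ps *; apply: rpowS => //; exact: IH.
Qed.

Hypothesis J_upper :
  forall z a, D 0 z -> P z -> J a -> Phi (z + a) -> J (z + a).

(** Same regrouping: [z] is absorbed either by the leading element of [J] or, by induction, by the
    remaining summand. *)
Lemma rpow_upper k z x : D 0 z -> P z -> rpow Phi J k.+1 x -> Phi (z + x) ->
  rpow Phi J k.+1 (z + x).
Proof.
move=> Dz Pz; elim: k x => [x|k IH x [[a Ja [x' Jx' <-]] Px] Ps].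
  exact: J_upper.
have Da := J_sub Ja; have Dx' := rpow_grade Jx'.
have Ds := gradeD Dz (gradeD Da Dx' Px) Ps.
have E : a + x' + z = z + (a + x') by rewrite addrC.
have [] := root_exchange Phi_root Phi_crys (grade_root Da)
  (grade_root Dx') (grade_root Dz) Px; first by rewrite E.
- case=> [az0|Paz].
    by move: Ds; rewrite -E (addrAC a) az0 (add0r x') => /(grade_inj Dx'); lia.
  rewrite addrC in Paz; rewrite addrA in Ps *; apply: rpowS => //.
  exact: J_upper.
- case=> [xz0|Pxz].
    by move: Ds; rewrite -E -(addrA a) xz0 addr0 => /(grade_inj Da); lia.
  rewrite addrC in Pxz; rewrite addrCA in Ps *; apply: rpowS => //.
  exact: IH.
Qed.

Hypothesis P_total : forall a, Phi a -> P a \/ P (- a).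

(** Induction on the power containing [x + y = a + b]: [a] is split off [x], and the degree of
    [x - a], or its sign in degree 0, tells which summand is generated by [J]. *)
Lemma rgen_coclosed i j x y : 1 <= i -> 1 <= j -> D i x -> D j y ->
  rgen Phi J (x + y) -> rgen Phi J x \/ rgen Phi J y.
Proof.
move=> i1 j1 Dx Dy [[//|k] _ Js].
elim: k i j x y i1 j1 Dx Dy Js => [|k IH] i j x y i1 j1 Dx Dy Js.
  (* An element of [J] has degree 1, but [x + y] has degree [i + j], at least 2. *)
  have /= Ps := grade_root (J_sub Js).
  have := grade_inj (J_sub Js) (gradeD Dx Dy Ps); lia.
have Ps := grade_root (rpow_grade Js).
have Px := grade_root Dx; have Py := grade_root Dy.
case: Js => -[a Ja [b Jb Es]] _.
have Da := J_sub Ja; have Pa := grade_root Da.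
have Db := rpow_grade Jb; have Pb := grade_root Db.
have genJ u : J u -> rgen Phi J u by move=> Ju; exists 1.
(* The exchange property for [x], [y], [- a], whose sum is the root [b], gives this for [x] or for
   [y]; the claim is symmetric in them. *)
wlog : i j x y i1 j1 Dx Dy Ps Px Py Es / x = a \/ Phi (x - a).
  move=> wl.
  have Eb : x + y - a = b by rewrite -Es addrC addKr.
  have [] := root_exchange Phi_root Phi_crys Px Py (rootN Phi_root Pa) Ps.
  - by rewrite Eb.
  - by move=> [/subr0_eq|] xa; apply: (wl i j); auto.
  - move=> ya; apply/or_comm; apply: (wl j i) => //.
    + by rewrite addrC.
    + by rewrite Es addrC.
    + by case: ya => [/subr0_eq|]; auto.
case=> [->|Pxa]; first by left; apply: genJ.
have Dxa := gradeB Da Dx Pxa.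
have Eb : b = (x - a) + y by rewrite addrAC -Es addrC addKr.
have [i_gt1|i_le1] := ltP 1 i.
  have i1' : 1 <= i - 1 by lia.
  rewrite Eb in Jb.
  have [[k' k'1 Jxa]|Jy] := IH _ _ _ _ i1' j1 Dxa Dy Jb.
  - left; exists k'.+1 => //; case: k' k'1 Jxa => // k' _ Jxa.
    by rewrite -[x](subrK a) addrC; apply: rpowS; rewrite // addrC subrK.
  - by right.
have i_eq1 : i = 1 by lia.
rewrite i_eq1 in Dx Dxa; rewrite subrr in Dxa.
(* Now [x - a] has degree 0. If it is positive, it moves [a] up to [x] inside [J]; otherwise [a - x]
   is positive and moves [b] up to [y]. *)
have [Pxa_pos|] := P_total Pxa.
  left; apply: genJ; rewrite -[x](subrK a).
  by apply: J_upper; rewrite // subrK.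
rewrite opprB => Pax_pos; right; exists k.+1 => //.
have Ey : y = (a - x) + b by rewrite Eb addrA addrA subrK subrr add0r.
rewrite Ey; apply: rpow_upper; rewrite -?Ey //.
have := gradeB Dx Da; rewrite subrr; apply.
by rewrite -opprB; apply: (rootN Phi_root).
Qed.

End GradedPowers.

(** * Closedness of the set and of its complement in the positive roots *)

Theorem theorem3p4 (R : realType) (V : vectType R) (dot : {dot V for idfun})
    (Delta : set V) (Pi : seq V) (D : int -> set V) (I : set V)
    (Delta_root : root_system dot Delta)
    (Delta_irr : irreducible dot Delta)
    (Delta_red : reduced Delta)
    (Delta_crys : crystallographic dot Delta)
    (Pi_simple : simple_system Delta Pi)
    (D_grading : Zgrading Delta D)
    (D_compat : compatible dot D (positive_roots Delta Pi))
    (I_ideal : lower_ideal Pi (D 1) I) :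
  biconvex Delta (positive_roots Delta Pi)
    ((\bigcup_(j in [set j : int | 1 <= j]) D j) `\` rgen Delta (D 1 `\` I)).
Proof.
have [D0p [_ [Pi0 _ D0pE] posE]] := D_compat.
set J := D 1 `\` I; set P := positive_roots Delta Pi in posE *.
have J_sub : J `<=` D 1 by move=> a [].
have J_upper z a : D 0 z -> P z -> J a -> Delta (z + a) -> J (z + a).
  move=> Dz [_ Pz] [Da nIa] Dza; split; first by rewrite -[1]add0r; exact: (gradeD D_grading).
  (* The difference of [z + a] and [a] is the positive root [z], so [z + a] in [I] would force [a]
     into [I]. *)
  move=> Iza; apply: nIa; case: I_ideal => _ /(_ a (z + a) Iza Da); apply.
  by rewrite /root_le addrK.
have P_total a : Delta a -> P a \/ P (- a).
  move=> Da; have := rootN Delta_root Da; case: Pi_simple => _ _ /(_ a Da).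
  by rewrite /P /positive_roots; case; [left|right].
have rgen_pos a : rgen Delta J a -> exists2 j : int, 1 <= j & D j a.
  move=> [[//|k] _ Jk]; exists k.+1 => //.
  exact: (rpow_grade D_grading J_sub Jk).
have D_pos j a : 1 <= j -> D j a -> P a by move=> j1 Da; rewrite posE; right; exists j.
have P_D0 a : P a -> D 0 a \/ exists2 j : int, 1 <= j & D j a.
  by rewrite posE D0pE; case=> [[? _]|]; [left|right].
have N_cases a : (P `\` ((\bigcup_(j in [set j : int | 1 <= j]) D j) `\` rgen Delta J)) a ->
    P a /\ (D 0 a \/ rgen Delta J a).
  move=> [Pa nM]; split=> //; case: (P_D0 a Pa) => [|Dj]; first by left.
  by right; apply: contrapT => nJ; apply: nM.
split.
- by move=> a [[j /= j1 Da] _]; apply: D_pos Da.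
- move=> a b [[i /= i1 Da] nJa] [[j /= j1 Db] nJb] Dab; split.
    exists (i + j); first by rewrite /=; lia.
    exact: (gradeD D_grading).
  move=> /(rgen_coclosed Delta_root Delta_crys D_grading J_sub J_upper P_total i1 j1 Da Db).
  by case.
move=> a b /N_cases[Pa Ca] /N_cases[Pb Cb] Dab; split.
  by split=> //; apply: nncombD; [case: Pa|case: Pb].
have upper z x : D 0 z -> P z -> rgen Delta J x -> Delta (z + x) -> rgen Delta J (z + x).
  move=> Dz Pz [[//|k] _ Jx] Dzx; exists k.+1 => //.
  exact: (rpow_upper Delta_root Delta_crys D_grading J_sub J_upper).
(* Suppose [a + b] is in the set. Two summands of degree 0 contradict its positive degree; in every
   other case [a + b] lies in [rgen Delta J]. *)
case: Ca Cb => [D0a|[[//|k] _ Ja]] [D0b|[[//|l] _ Jb]] [[j /= j1 Dj] []].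
- by have := grade_inj D_grading Dj (gradeD D_grading D0a D0b Dab); lia.
- by apply: upper => //; exists l.+1.
- by rewrite addrC in Dab *; apply: upper => //; exists k.+1.
- by exists (k + l).+2 => //; apply: (rpowD Delta_root Delta_crys D_grading J_sub).
Qed.
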